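(* Let $M$ be a square matrix over a field with rows and columns indexed by a finite set $V$, and let $X \subseteq V$ be such that $M[X]$ is non-singular. Then \[ P_{\langle \delta \rangle}(M, z) = P_{\langle \delta \rangle}(M \ast X, z). \] In particular, if $M$ is invertible, then \[ P_{\langle \delta \rangle}(M, z) = P_{\langle \delta \rangle}(M \ast V, z) = P_{\langle \delta \rangle}(M^{-1}, z). \]
   Context: For a square matrix $M$ over a field with rows and columns indexed by a finite set $V$, and $A \subseteq V$, $M[A]$ denotes the principal submatrix of $M$ on $A$ and $A^c = V \setminus A$. The partial-$\langle\delta\rangle$ polynomial of $M$ is \[ P_{\langle \delta \rangle}(M, z) = \sum_{A \subseteq V} z^{\operatorname{rank}(M[A]) + \operatorname{rank}(M[A^c])} \] (with $P_{\langle \delta \rangle}(M,z)=1$ for the empty $0\times 0$ matrix). For $X \subseteq V$ with $M[X]$ non-singular, the pivot $M \ast X$ is defined as follows: write $M = \begin{pmatrix} P & Q \\ R & S \end{pmatrix}$ with $P = M[X]$ (rows/columns ordered with $X$ first); then \[ M \ast X = \begin{pmatrix} P^{-1} & -P^{-1}Q \\ RP^{-1} & S - RP^{-1}Q \end{pmatrix}. \] In particular $M \ast V = M^{-1}$ when $M$ is invertible. *)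

(* Defs.v *)
From mathcomp Require Import all_boot all_order all_algebra.

Set Implicit Arguments.
Unset Strict Implicit.
Unset Printing Implicit Defensive.

Import GRing.Theory.
Local Open Scope ring_scope.

(* A matrix with rows and columns indexed by a finite type V is rendered as
   M : 'M[F]_#|V|: the row (or column) of v : V has number enum_rank v. *)

Section IndexedMatrices.

Variables (F : fieldType) (V : finType).
Implicit Types (M : 'M[F]_#|V|) (A B X : {set V}).

Definition submx_on M A B : 'M[F]_(#|A|, #|B|) :=
  mxsub (fun i => enum_rank (enum_val i)) (fun j => enum_rank (enum_val j)) M.

Definition principal_submx M A : 'M[F]_#|A| := submx_on M A A.

Definition partial_delta_poly M : {poly int} :=
  \sum_(A : {set V})
    'X^(\rank (principal_submx M A) + \rank (principal_submx M (~: A))).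

Lemma notin_in_setC X v : ~ (v \in X) -> v \in ~: X.
Proof. by rewrite in_setC => /negP. Qed.

(* The position of v when V is reordered with the elements of X first. *)
Definition block_rank X (v : V) : 'I_(#|X| + #|~: X|) :=
  match decP (@idP (v \in X)) with
  | left vX => lshift _ (enum_rank_in vX v)
  | right vNX => rshift _ (enum_rank_in (notin_in_setC vNX) v)
  end.

(* Only meaningful when principal_submx M X is invertible, as invmx is the
   identity on singular matrices. *)
Definition pivot M X : 'M[F]_#|V| :=
  let P := submx_on M X X in
  let Q := submx_on M X (~: X) in
  let R := submx_on M (~: X) X in
  let S := submx_on M (~: X) (~: X) in
  let N := block_mx (invmx P) (- (invmx P *m Q))
                    (R *m invmx P) (S - R *m invmx P *m Q) in
  mxsub (fun i => block_rank X (enum_val i))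
        (fun j => block_rank X (enum_val j)) N.

End IndexedMatrices.

(* Main.v *)
Require Import Defs.
From mathcomp Require Import all_boot all_order all_algebra.

Set Implicit Arguments.
Unset Strict Implicit.
Unset Printing Implicit Defensive.

Import GRing.Theory.
Local Open Scope ring_scope.

(** Let [N(M, A)] be [M] with the rows outside [A] replaced by those of the
    identity, so that [rank N(M, A) = rank M[A] + |A^c|].  The exchange of
    inputs and outputs indexed by [X] reads [(M * X) N(M, X) = N'(M, X)], where
    [N'] replaces the rows inside [X] instead; hence
    [N(M * X, A) N(M, X) = N(M, A + X)], with [+] the symmetric difference.  As
    [N(M, X)] is invertible, the matrices [(M * X)[A]] and [M[A + X]] have the
    same nullity.  Since [A^c + X = (A + X)^c], the bijection [A |-> A + X]
    matches the terms of the two polynomials. *)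

Section MixRows.

Variables (F : fieldType) (V : finType).
Implicit Types (M K L : 'M[F]_#|V|) (A B X : {set V}).

(** With [K] arbitrary, one operation yields both matrices: N(M, X) is [mix_rows X M 1%:M] and N'(M,
    X) is [mix_rows X 1%:M M]. *)
Definition mix_rows A M K : 'M[F]_#|V| :=
  \matrix_(i, j) if enum_val i \in A then M i j else K i j.

Lemma mix_rows_mul A M K L :
  mix_rows A M K *m L = mix_rows A (M *m L) (K *m L).
Proof.
apply/matrixP=> i j; rewrite !mxE.
by case: ifP => iA; apply: eq_bigr => k _; rewrite !mxE iA.
Qed.

Definition symdiff A B := (A :\: B) :|: (B :\: A).

Lemma in_symdiff A B v : (v \in symdiff A B) = (v \in A) (+) (v \in B).
Proof. by rewrite !inE; do 2!case: (v \in _). Qed.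

Lemma symdiffK X : involutive (symdiff ^~ X).
Proof. by move=> A; apply/setP=> v; rewrite !in_symdiff addbK. Qed.

Lemma symdiffC A X : symdiff (~: A) X = ~: symdiff A X.
Proof. by apply/setP=> v; rewrite !(in_symdiff, inE); do 2!case: (v \in _). Qed.

Lemma mix_rows_symdiff A X M K :
  mix_rows A (mix_rows X K M) (mix_rows X M K) = mix_rows (symdiff A X) M K.
Proof.
by apply/matrixP=> i j; rewrite !mxE in_symdiff; do 2!case: (_ \in _).
Qed.

End MixRows.

Lemma mxsub_bij_mul (R : pzSemiRingType) m n (f : 'I_n -> 'I_m)
    (A B : 'M[R]_m) : bijective f ->
  mxsub f f (A *m B) = mxsub f f A *m mxsub f f B.
Proof.
move=> f_bij; apply/matrixP=> i j; rewrite !mxE (reindex f) /=.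
  by apply: eq_bigr => k _; rewrite !mxE.
exact: onW_bij.
Qed.

Lemma mxrank_mxsub_bij (F : fieldType) m n (f : 'I_n -> 'I_m) (A : 'M[F]_m) :
  bijective f -> \rank (mxsub f f A) = \rank A.
Proof.
(* Selecting rows and columns is multiplication by submatrices of the identity, so it cannot raise
   the rank. Applied to [f] and to its inverse, this gives equality. *)
have le_sub p q (h : 'I_q -> 'I_p) (B : 'M[F]_p) :
    (\rank (mxsub h h B) <= \rank B)%N.
  have -> : mxsub h h B = rowsub h 1%:M *m B *m colsub h 1%:M.
    by rewrite mul_rowsub_mx mul1mx mulmx_colsub mulmx1 -mxsub_comp.
  exact: leq_trans (mxrankM_maxl _ _) (mxrankM_maxr _ _).
case=> g fK gK; apply/eqP; rewrite eqn_leq le_sub /=.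
suff {1}-> : A = mxsub g g (mxsub f f A) by apply: le_sub.
by apply/matrixP=> i j; rewrite !mxE !gK.
Qed.

Section Pivot.

Variables (F : fieldType) (V : finType).
Implicit Types (M : 'M[F]_#|V|) (A X : {set V}).

Let pos X (i : 'I_#|V|) := block_rank X (enum_val i).

Let pos_inv X (k : 'I_(#|X| + #|~: X|)) : 'I_#|V| :=
  enum_rank (match split k with inl i => enum_val i | inr j => enum_val j end).

Lemma block_rank_in X (i : 'I_#|X|) :
  block_rank X (enum_val i) = lshift _ i.
Proof.
rewrite /block_rank; case: (decP _) => [iX|iNX]; first by rewrite enum_valK_in.
by case: iNX; apply: enum_valP.
Qed.

Lemma block_rank_notin X (i : 'I_#|~: X|) :
  block_rank X (enum_val i) = rshift _ i.
Proof.
rewrite /block_rank; case: (decP _) => [iX|iNX]; last by rewrite enum_valK_in.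
by have := enum_valP i; rewrite inE iX.
Qed.

Let pos_invK X : cancel (@pos_inv X) (pos X).
Proof.
move=> k; rewrite /pos /pos_inv enum_rankK -[RHS]splitK.
by case: (split k) => i /=; rewrite ?block_rank_in ?block_rank_notin.
Qed.

Let posK X : cancel (pos X) (@pos_inv X).
Proof.
move=> i; apply: enum_val_inj; rewrite enum_rankK /pos /block_rank.
case: (decP _) => [iX|iNX].
  by rewrite -[lshift _ _]/(unsplit (inl _)) unsplitK enum_rankK_in.
rewrite -[rshift _ _]/(unsplit (inr _)) unsplitK enum_rankK_in // inE.
exact/negP.
Qed.

Let pos_bij X : bijective (pos X).
Proof. by exists (@pos_inv X). Qed.

Definition mx_blocks M X :=
  block_mx (submx_on M X X) (submx_on M X (~: X))
           (submx_on M (~: X) X) (submx_on M (~: X) (~: X)).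

Lemma mxsub_mx_blocks M X :
  mxsub (fun i => block_rank X (enum_val i))
        (fun i => block_rank X (enum_val i)) (mx_blocks M X) = M.
Proof.
apply/matrixP=> i j.
rewrite -[i in RHS](posK X) -[j in RHS](posK X) mxE -!/(pos X _) /pos_inv.
rewrite -[pos X i in LHS]splitK -[pos X j in LHS]splitK /mx_blocks.
case: (split (pos X i)) => k; case: (split (pos X j)) => l /=;
by rewrite ?(block_mxEul, block_mxEur, block_mxEdl, block_mxEdr) mxE.
Qed.

(** In the block order the rows of [X] come first, so mixing along [X] takes the upper block of one
    matrix and the lower block of the other. *)
Lemma mix_rows_mxsub X (u v : 'M[F]_(#|X|, #|X| + #|~: X|))
    (w z : 'M[F]_(#|~: X|, #|X| + #|~: X|)) :
  mix_rows X (mxsub (pos X) (pos X) (col_mx u w))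
             (mxsub (pos X) (pos X) (col_mx v z)) =
  mxsub (pos X) (pos X) (col_mx u z).
Proof.
apply/matrixP=> i j; rewrite !mxE; move: (pos X j) => l.
rewrite /pos /block_rank; case: (decP _) => [iX|iNX].
  by rewrite iX -[lshift _ _]/(unsplit (inl _)) unsplitK.
by rewrite (introF idP iNX) -[rshift _ _]/(unsplit (inr _)) unsplitK.
Qed.

Lemma mxsub_pos1 X : mxsub (pos X) (pos X) 1%:M = 1%:M :> 'M[F]_#|V|.
Proof. by apply/matrixP=> i j; rewrite !mxE (can_eq (@posK X)). Qed.

Lemma mix_rows_inside M X :
  mix_rows X M 1%:M = mxsub (pos X) (pos X)
    (block_mx (submx_on M X X) (submx_on M X (~: X)) 0 1%:M).
Proof.
rewrite -{1}(mxsub_mx_blocks M X) -(mxsub_pos1 X) scalar_mx_block.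
exact: mix_rows_mxsub.
Qed.

Lemma mix_rows_outside M X :
  mix_rows X 1%:M M = mxsub (pos X) (pos X)
    (block_mx 1%:M 0 (submx_on M (~: X) X) (submx_on M (~: X) (~: X))).
Proof.
rewrite -{1}(mxsub_mx_blocks M X) -(mxsub_pos1 X) scalar_mx_block.
exact: mix_rows_mxsub.
Qed.

Lemma mxrank_mix_rows M A :
  \rank (mix_rows A M 1%:M) = (\rank (principal_submx M A) + #|~: A|)%N.
Proof.
rewrite mix_rows_inside mxrank_mxsub_bij // /principal_submx.
set P := submx_on M A A; set Q := submx_on M A _.
(* The left factor is unitriangular, so only the rank of the block diagonal factor remains. *)
have -> : block_mx P Q 0 1%:M = block_mx 1%:M Q 0 1%:M *m block_mx P 0 0 1%:M.
  by rewrite mulmx_block !(mul1mx, mulmx1, mul0mx, mulmx0, addr0, add0r).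
rewrite eqmxMfull ?rank_diag_block_mx ?mxrank1 //.
by rewrite row_full_unit unitmxE det_ublock !det1 mulr1 unitr1.
Qed.

Lemma pivot_mul M X : principal_submx M X \in unitmx ->
  pivot M X *m mix_rows X M 1%:M = mix_rows X 1%:M M.
Proof.
move=> uP; rewrite mix_rows_inside mix_rows_outside -mxsub_bij_mul //.
(* Invertibility of P serves in the left blocks, P^-1 P = 1 and R P^-1 P = R; in the right blocks
   the terms P^-1 Q and R P^-1 Q cancel. *)
congr mxsub; rewrite mulmx_block -[X in invmx X]/(principal_submx M X).
rewrite -/(principal_submx M X) !mulmx0 !mulmx1 !addr0 mulVmx // mulmxKV //.
by rewrite subrr addrC subrK.
Qed.

Lemma mxrank_pivot M X A : principal_submx M X \in unitmx ->
  (\rank (principal_submx (pivot M X) A) + #|~: A| =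
   \rank (principal_submx M (symdiff A X)) + #|~: symdiff A X|)%N.
Proof.
move=> uP; rewrite -!mxrank_mix_rows -mix_rows_symdiff -(pivot_mul uP).
set N := mix_rows X M 1%:M.
have -> : mix_rows A (pivot M X *m N) N = mix_rows A (pivot M X) 1%:M *m N.
  by rewrite mix_rows_mul mul1mx.
rewrite mxrankMfree //.
(* [N] has rank |X| + |X^c| = |V|. *)
by rewrite /row_free mxrank_mix_rows mxrank_unit // cardsC.
Qed.

Lemma partial_delta_poly_pivot M X : principal_submx M X \in unitmx ->
  partial_delta_poly M = partial_delta_poly (pivot M X).
Proof.
move=> uP; rewrite /partial_delta_poly (reindex_inj (inv_inj (symdiffK X))) /=.
apply: eq_bigr => A _; congr 'X^_.
have eqA := mxrank_pivot A uP; have eqAc := mxrank_pivot (~: A) uP.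
rewrite symdiffC !setCK in eqAc *.
(* Only the sum of the two ranks is preserved: the corrections for a set and its complement add up
   to |V| on either side. *)
apply/eqP; rewrite -(eqn_add2r #|V|) -{1}(cardsC (symdiff A X)) -(cardsC A).
rewrite [(#|symdiff A X| + _)%N]addnC [(#|A| + _)%N]addnC.
by rewrite addnACA -eqA -eqAc addnACA.
Qed.

Lemma mix_rowsT M (K : 'M[F]_#|V|) : mix_rows [set: V] M K = M.
Proof. by apply/matrixP=> i j; rewrite !mxE inE. Qed.

(** [principal_submx M [set: V]] has size [#|[set: V]|], so it is not literally [M]; the rank
    formula with empty complement avoids reindexing. *)
Lemma principal_submxT_unit M :
  M \in unitmx -> principal_submx M [set: V] \in unitmx.
Proof.
move=> uM; rewrite -row_full_unit /row_full -(eqn_add2r #|~: [set: V]|).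
by rewrite -mxrank_mix_rows mix_rowsT mxrank_unit // cardsC.
Qed.

(** For X = V the exchange identity reads (M * V) M = 1, so no block needs to be computed. *)
Lemma pivotT M : M \in unitmx -> pivot M [set: V] = invmx M.
Proof.
move=> uM; have := pivot_mul (principal_submxT_unit uM).
by rewrite !mix_rowsT => /(canRL (mulmxK uM)); rewrite mul1mx.
Qed.

End Pivot.

Theorem theorem5p2 (F : fieldType) (V : finType) (M : 'M[F]_#|V|) :
  (forall X : {set V}, principal_submx M X \in unitmx ->
     partial_delta_poly M = partial_delta_poly (pivot M X)) /\
  (M \in unitmx ->
     partial_delta_poly M = partial_delta_poly (pivot M [set: V]) /\
     partial_delta_poly (pivot M [set: V]) = partial_delta_poly (invmx M)).
Proof.
split=> [X|uM]; first exact: partial_delta_poly_pivot.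
rewrite -pivotT //; split=> //.
exact/partial_delta_poly_pivot/principal_submxT_unit.
Qed.
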